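(* For $\rho>0$ and $\xi\in\mathbb{R}$ let $U(\rho,\xi)=\begin{pmatrix}\rho&0\\0&1/\rho\end{pmatrix}\begin{pmatrix}1&\xi\\0&1\end{pmatrix}$ and let $g_{\rho,\xi}$ be the isotropy defined by the triple $(U(\rho,\xi),U(\rho,\xi),U(\rho,\xi))$. Let $\mathcal{S}$ be Strassen's tensor decomposition. The minimal value of $\gamma_{2,1}(g_{\rho,\xi}\diamond\mathcal{S})$ over all $\rho>0$, $\xi\in\mathbb{R}$ is reached at the point $(\rho,\xi)=\bigl(\sqrt[4]{4/3},\,-1/2\bigr)$ and is equal to $\frac{4}{\sqrt2}+\frac{16}{\sqrt3}>12.06603$.
   Context: A decomposition is a finite sum $\sum_i M_i\otimes N_i\otimes O_i$ of rank-one tensors of real $2\times2$ matrices (regarded together with its list of summands). Its $\gamma_{2,1}$ growth factor is $\gamma_{2,1}=\sum_i\|M_i\|_F\|N_i\|_F\|O_i\|_F$, with $\|\cdot\|_F$ the Frobenius norm. The isotropy $g=(U,V,W)$, with $U,V,W$ real $2\times 2$ matrices of determinant $\pm1$, acts on a rank-one tensor by $$g\diamond(A\otimes B\otimes C)=(U^{-\intercal}AV^{\intercal})\otimes(V^{-\intercal}BW^{\intercal})\otimes(W^{-\intercal}CU^{\intercal}),$$ and on decompositions summand by summand. Strassen's tensor decomposition is $$\begin{aligned}\mathcal{S}={}&\begin{pmatrix}1&0\\0&1\end{pmatrix}\otimes\begin{pmatrix}1&0\\0&1\end{pmatrix}\otimes\begin{pmatrix}1&0\\0&1\end{pmatrix}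 +\begin{pmatrix}0&1\\0&-1\end{pmatrix}\otimes\begin{pmatrix}0&0\\1&1\end{pmatrix}\otimes\begin{pmatrix}1&0\\0&0\end{pmatrix}\\ &+\begin{pmatrix}-1&0\\1&0\end{pmatrix}\otimes\begin{pmatrix}1&1\\0&0\end{pmatrix}\otimes\begin{pmatrix}0&0\\0&1\end{pmatrix} +\begin{pmatrix}1&1\\0&0\end{pmatrix}\otimes\begin{pmatrix}0&0\\0&1\end{pmatrix}\otimes\begin{pmatrix}-1&0\\1&0\end{pmatrix}\\ &+\begin{pmatrix}1&0\\0&0\end{pmatrix}\otimes\begin{pmatrix}0&1\\0&-1\end{pmatrix}\otimes\begin{pmatrix}0&0\\1&1\end{pmatrix} +\begin{pmatrix}0&0\\0&1\end{pmatrix}\otimes\begin{pmatrix}-1&0\\1&0\end{pmatrix}\otimes\begin{pmatrix}1&1\\0&0\end{pmatrix}\\ &+\begin{pmatrix}0&0\\1&1\end{pmatrix}\otimes\begin{pmatrix}1&0\\0&0\end{pmatrix}\otimes\begin{pmatrix}0&1\\0&-1\end{pmatrix}.\end{aligned}$$ *)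

(* Defs.v *)
From mathcomp Require Import all_boot all_order all_algebra.
From mathcomp Require Import reals.

Set Implicit Arguments.
Unset Strict Implicit.
Unset Printing Implicit Defensive.

Import Order.TTheory GRing.Theory Num.Theory.
Local Open Scope ring_scope.

Definition mx22 (R : realType) (a b c d : R) : 'M[R]_2 :=
  \matrix_(i, j) nth 0 (nth [::] [:: [:: a; b]; [:: c; d]] i) j.

Definition frobenius_norm (R : realType) (A : 'M[R]_2) : R :=
  Num.sqrt (\sum_(i < 2) \sum_(j < 2) A i j ^+ 2).

(* The triple (A, B, C) stands for the rank-one tensor A (x) B (x) C.  A
   nonzero tensor determines the triple up to rescaling the factors by scalars
   of product 1; both the growth factor and the action
   of isotropies below are compatible with such rescalings. *)
Definition summand (R : realType) : Type :=
  ('M[R]_2 * 'M[R]_2 * 'M[R]_2)%type.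

(* A decomposition is kept as its list of summands, because its growth factor
   depends on the summands and not only on the tensor they add up to. *)
Definition decomposition (R : realType) : Type := seq (summand R).

Definition growth_factor21 (R : realType) (D : decomposition R) : R :=
  \sum_(t <- D)
    let: (A, B, C) := t in
    frobenius_norm A * frobenius_norm B * frobenius_norm C.

Definition mx_triple (R : realType) : Type :=
  ('M[R]_2 * 'M[R]_2 * 'M[R]_2)%type.

Definition det_pm1 (R : realType) (U : 'M[R]_2) : Prop :=
  \det U = 1 \/ \det U = -1.

Definition is_isotropy (R : realType) (g : mx_triple R) : Prop :=
  let: (U, V, W) := g in [/\ det_pm1 U, det_pm1 V & det_pm1 W].

(* [invmx] is the inverse only on invertible matrices, hence this is the
   intended action only for [g] satisfying [is_isotropy]. *)
Definition act_summand (R : realType) (g : mx_triple R) (t : summand R) :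
    summand R :=
  let: (U, V, W) := g in
  let: (A, B, C) := t in
  ((invmx U)^T *m A *m V^T, (invmx V)^T *m B *m W^T, (invmx W)^T *m C *m U^T).

Definition act (R : realType) (g : mx_triple R) (D : decomposition R) :
    decomposition R :=
  [seq act_summand g t | t <- D].

Definition strassen (R : realType) : decomposition R :=
  [:: (mx22 1 0 0 1,     mx22 1 0 0 1,     mx22 1 0 0 1);
      (mx22 0 1 0 (-1),  mx22 0 0 1 1,     mx22 1 0 0 0);
      (mx22 (-1) 0 1 0,  mx22 1 1 0 0,     mx22 0 0 0 1);
      (mx22 1 1 0 0,     mx22 0 0 0 1,     mx22 (-1) 0 1 0);
      (mx22 1 0 0 0,     mx22 0 1 0 (-1),  mx22 0 0 1 1);
      (mx22 0 0 0 1,     mx22 (-1) 0 1 0,  mx22 1 1 0 0);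
      (mx22 0 0 1 1,     mx22 1 0 0 0,     mx22 0 1 0 (-1))].

Definition Umx (R : realType) (rho xi : R) : 'M[R]_2 :=
  mx22 rho 0 0 (1 / rho) *m mx22 1 xi 0 1.

Definition g_iso (R : realType) (rho xi : R) : mx_triple R :=
  (Umx rho xi, Umx rho xi, Umx rho xi).

Lemma det_mx22 (R : realType) (a b c d : R) :
  \det (mx22 a b c d) = a * d - b * c.
Proof.
rewrite (expand_det_row _ ord0) !big_ord_recl big_ord0 /cofactor !det_mx11.
by rewrite !mxE /= expr0 expr1 mul1r mulN1r addr0 mulrN.
Qed.

Lemma g_iso_isotropy (R : realType) (rho xi : R) :
  0 < rho -> is_isotropy (g_iso rho xi).
Proof.
move=> rho_gt0.
suff dU : det_pm1 (Umx rho xi) by split.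
left; rewrite det_mulmx !det_mx22 !mulr0 !subr0 mulr1 mulr1 div1r.
by rewrite divff // gt_eqF.
Qed.

(* Main.v *)
(** Conjugation by [P = U^{-T}] fixes the first summand of Strassen's
    decomposition, and sends a rank-one factor [u v^T] to a matrix whose norm is
    [|P u| |P v'|], where [v'] is [v] rotated by a right angle (as [det P = 1]).
    In each of the other six summands the vectors [u], [v'] of the three factors
    are, up to sign, the three pairs out of [(1,0)], [(0,1)], [(1,-1)], so that
    [gamma = 2 sqrt 2 + 6 a b c] with [a], [b], [c] the squared norms of their
    images under [P]. With [r = rho^2],
    [r a b c = (1 + (r xi)^2) (1 + (r (1 + xi))^2)
             = (1 + r^2 xi (1 + xi))^2 + r^2],
    where [r^2 xi (1 + xi) >= - r^2 / 4]. Hence it is at least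
    [(1 - r^2 / 4)^2 + r^2 = (1 + r^2 / 4)^2] if [r <= 2], with equality for
    [xi = -1/2], and at least [r^2 >= 2 r] otherwise. Both are at least
    [8 r / (3 sqrt 3)], which is tangent to [(1 + r^2 / 4)^2] at
    [r = 2 / sqrt 3]. *)
Require Import Defs.
From mathcomp Require Import all_boot all_order all_algebra.
From mathcomp Require Import reals ring lra.

Import Order.TTheory GRing.Theory Num.Theory.
Local Open Scope ring_scope.

Lemma mulmx_mx22 (R : realType) (a b c d a' b' c' d' : R) :
  mx22 a b c d *m mx22 a' b' c' d' =
  mx22 (a * a' + b * c') (a * b' + b * d') (c * a' + d * c') (c * b' + d * d').
Proof.
apply/matrixP => i j; rewrite !mxE !big_ord_recl big_ord0 !mxE /= addr0.
by case: i => [[|[|//]]] ?; case: j => [[|[|//]]] ?.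
Qed.

Lemma trmx_mx22 (R : realType) (a b c d : R) : (mx22 a b c d)^T = mx22 a c b d.
Proof.
apply/matrixP => i j; rewrite !mxE.
by case: i => [[|[|//]]] ?; case: j => [[|[|//]]] ?.
Qed.

Lemma mx22_1 (R : realType) : mx22 1 0 0 1 = 1%:M :> 'M[R]_2.
Proof.
apply/matrixP => i j; rewrite !mxE.
by case: i => [[|[|//]]] ?; case: j => [[|[|//]]] ?.
Qed.

Lemma frobenius_norm_mx22 (R : realType) (a b c d : R) :
  frobenius_norm (mx22 a b c d) =
  Num.sqrt (a ^+ 2 + b ^+ 2 + c ^+ 2 + d ^+ 2).
Proof.
rewrite /frobenius_norm !big_ord_recl !big_ord0 !mxE /=; congr Num.sqrt; ring.
Qed.

Lemma UmxE (R : realType) (rho xi : R) :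
  Umx rho xi = mx22 rho (rho * xi) 0 rho^-1.
Proof. by rewrite /Umx mulmx_mx22; congr mx22; ring. Qed.

Lemma invmx_Umx (R : realType) (rho xi : R) : 0 < rho ->
  invmx (Umx rho xi) = mx22 rho^-1 (- (rho * xi)) 0 rho.
Proof.
move=> rho0; have rhoN0 : rho != 0 by rewrite gt_eqF.
have VU : mx22 rho^-1 (- (rho * xi)) 0 rho *m Umx rho xi = 1%:M.
  by rewrite UmxE mulmx_mx22 -mx22_1; congr mx22; field.
have [_ uU] := mulmx1_unit VU.
by rewrite -[LHS]mul1mx -VU mulmxK.
Qed.

Lemma conj_Umx (R : realType) (rho xi a b c d : R) : 0 < rho ->
  (invmx (Umx rho xi))^T *m mx22 a b c d *m (Umx rho xi)^T =
  mx22 (a + b * xi) (b / rho ^+ 2)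
       (rho ^+ 2 * (c + d * xi - xi * (a + b * xi))) (d - xi * b).
Proof.
move=> rho0; have rhoN0 : rho != 0 by rewrite gt_eqF.
rewrite invmx_Umx // UmxE !trmx_mx22 !mulmx_mx22; congr mx22; by field.
Qed.

(* [|P (x, y)|^2] with [P = U^{-T}]. *)
Definition sqnorm_image {R : realType} (rho xi x y : R) : R :=
  x ^+ 2 / rho ^+ 2 + rho ^+ 2 * (y - xi * x) ^+ 2.

Lemma sqnorm_image_ge0 (R : realType) (rho xi x y : R) :
  0 <= sqnorm_image rho xi x y.
Proof.
by apply: addr_ge0; [apply: divr_ge0 | apply: mulr_ge0]; apply: sqr_ge0.
Qed.

(** Here [A = u v^T] with [u = (x, y)] and [v = (t, -z)], so [(z, t)] is [v] turned by a right
    angle; as [det P = 1], the row [v^T P^-1] has the norm of [P (z, t)]. *)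
Lemma frobenius_norm_conj_rank1 (R : realType) (rho xi x y z t : R) (A : 'M_2) :
  0 < rho -> A = mx22 (x * t) (- (x * z)) (y * t) (- (y * z)) ->
  frobenius_norm ((invmx (Umx rho xi))^T *m A *m (Umx rho xi)^T) =
  Num.sqrt (sqnorm_image rho xi x y) * Num.sqrt (sqnorm_image rho xi z t).
Proof.
move=> rho0 ->; have rhoN0 : rho != 0 by rewrite gt_eqF.
rewrite conj_Umx // frobenius_norm_mx22 -sqrtrM ?sqnorm_image_ge0 //.
by congr Num.sqrt; rewrite /sqnorm_image; field.
Qed.

Lemma growth_factor21_strassen (R : realType) (rho xi : R) : 0 < rho ->
  growth_factor21 (act (g_iso rho xi) (strassen R)) =
  2 * Num.sqrt 2 +
  6 * ((1 + rho ^+ 4 * xi * (1 + xi)) ^+ 2 + rho ^+ 4) / rho ^+ 2.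
Proof.
move=> rho0; have rhoN0 : rho != 0 by rewrite gt_eqF.
rewrite /growth_factor21 /act /strassen /g_iso /= !big_cons big_nil.
rewrite !(conj_Umx _ _ _ 1 0 0 1) // frobenius_norm_mx22.
have N := frobenius_norm_conj_rank1 _ rho xi.
rewrite (N 1 (-1) (-1) 0) //; last by congr mx22; ring.
rewrite (N 0 1 (-1) 1) //; last by congr mx22; ring.
rewrite (N 1 0 0 1) //; last by congr mx22; ring.
rewrite (N (-1) 1 0 1) //; last by congr mx22; ring.
rewrite (N 1 0 (-1) 1) //; last by congr mx22; ring.
rewrite (N 0 1 (-1) 0) //; last by congr mx22; ring.
have qN x y : sqnorm_image rho xi (- x) (- y) = sqnorm_image rho xi x y.
  by rewrite /sqnorm_image; ring.
have -> : sqnorm_image rho xi (-1) 0 = sqnorm_image rho xi 1 0.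
  by rewrite -qN opprK oppr0.
have -> : sqnorm_image rho xi (-1) 1 = sqnorm_image rho xi 1 (-1).
  by rewrite -qN opprK.
have Sq x y := sqr_sqrtr (sqnorm_image_ge0 R rho xi x y).
have I : Num.sqrt ((1 + 0 * xi) ^+ 2 + (0 / rho ^+ 2) ^+ 2 +
    (rho ^+ 2 * (0 + 1 * xi - xi * (1 + 0 * xi))) ^+ 2 + (1 - xi * 0) ^+ 2)
    = Num.sqrt 2 :> R by congr Num.sqrt; ring.
rewrite I -expr2 sqr_sqrtr //.
(* Each of the three vectors occurs twice in every summand, so the square roots pair up into
   squares. *)
transitivity (2 * Num.sqrt 2 + 6 * (sqnorm_image rho xi 1 0 *
    sqnorm_image rho xi 0 1 * sqnorm_image rho xi 1 (-1))).
  by ring: (Sq 1 0) (Sq 0 1) (Sq 1 (-1)).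
by rewrite /sqnorm_image; field.
Qed.

(** Used with [r = rho^2] and [k = 1 / sqrt 3]; equality holds at [r = 2 k], [xi = -1/2]. *)
Lemma reduced_growth_lb (R : realType) (k r xi : R) :
  0 < k -> k ^+ 2 = 3^-1 -> 0 < r ->
  8 / 3 * k * r <= (1 + r ^+ 2 * xi * (1 + xi)) ^+ 2 + r ^+ 2.
Proof.
move=> k0 k2 r0; set p := r ^+ 2 * xi * _.
have pge : - (r ^+ 2 / 4) <= p.
  rewrite -subr_ge0 (_ : p - _ = (r * (xi + 1 / 2)) ^+ 2) ?sqr_ge0 //.
  by rewrite /p; field.
have [r2|r2] := lerP r 2.
  have r24 : r ^+ 2 <= 4 by nra.
  apply: (@le_trans _ _ ((1 + r ^+ 2 / 4) ^+ 2)).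
    (* The difference has the double root [r = 2 k]. *)
    have -> : (1 + r ^+ 2 / 4) ^+ 2 = 8 / 3 * k * r +
        (r - 2 * k) ^+ 2 * (r ^+ 2 / 16 + k * r / 4 + 3 / 4).
      have k2r2 : k ^+ 2 * r ^+ 2 = r ^+ 2 / 3 by rewrite k2 mulrC.
      have k3r : k ^+ 3 * r = k * r / 3 by rewrite exprS k2; field.
      lra.
    have := mulr_gt0 k0 r0; have := sqr_ge0 r => ? ?.
    rewrite lerDl mulr_ge0 ?sqr_ge0 //; lra.
  have -> : (1 + r ^+ 2 / 4) ^+ 2 = (1 - r ^+ 2 / 4) ^+ 2 + r ^+ 2 by field.
  (* As [r <= 2], [1 - r^2 / 4] is nonnegative, so its bound by [1 + p] may be squared. *)
  by rewrite lerD2r ler_sqr ?nnegrE; lra.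
(* Since [k <= 3/4], [8/3 k r <= 2 r <= r^2]. *)
have := sqr_ge0 (1 + p); have : k <= 3 / 4 by nra.
by nra.
Qed.

Theorem proposition15 (R : realType) :
  let gamma (rho xi : R) := growth_factor21 (act (g_iso rho xi) (strassen R)) in
  let rho0 : R := Num.sqrt (Num.sqrt (4 / 3)) in
  let xi0 : R := - (1 / 2) in
  [/\ 0 < rho0,
      forall rho xi : R, 0 < rho -> gamma rho0 xi0 <= gamma rho xi,
      gamma rho0 xi0 = 4 / Num.sqrt 2 + 16 / Num.sqrt 3
    & 4 / Num.sqrt 2 + 16 / Num.sqrt 3 > 12 + 6603 / 10 ^+ 5 :> R].
Proof.
move=> gamma rho0 xi0.
have s2 : Num.sqrt 2 ^+ 2 = 2 :> R by rewrite sqr_sqrtr.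
have s3 : Num.sqrt 3 ^+ 2 = 3 :> R by rewrite sqr_sqrtr.
have s2_gt0 : 0 < Num.sqrt 2 :> R by rewrite sqrtr_gt0.
have s3_gt0 : 0 < Num.sqrt 3 :> R by rewrite sqrtr_gt0.
have s2N0 : Num.sqrt 2 != 0 :> R by rewrite gt_eqF.
have q_gt0 : 0 < 4 / 3 :> R by lra.
have rho0_gt0 : 0 < rho0 by rewrite !sqrtr_gt0.
pose k : R := (Num.sqrt 3)^-1.
have k_gt0 : 0 < k by rewrite invr_gt0.
have k2 : k ^+ 2 = 3^-1 by rewrite exprVn s3.
have d2 : 4 / Num.sqrt 2 = 2 * Num.sqrt 2 :> R.
  by apply: (mulIf s2N0); rewrite divfK // -mulrA -expr2 s2; ring.
have rho0_sq : rho0 ^+ 2 = 2 * k.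
  rewrite sqr_sqrtr ?sqrtr_ge0 // (_ : 4 / 3 = (2 * k) ^+ 2).
    by rewrite sqrtr_sqr ger0_norm //; lra.
  by rewrite exprMn k2; field.
have gamma0 : gamma rho0 xi0 = 4 / Num.sqrt 2 + 16 / Num.sqrt 3.
  rewrite /gamma growth_factor21_strassen // d2; congr (_ + _).
  (* The numerator becomes [(1 - k^2)^2 + 4 k^2 = 16/9]. *)
  rewrite (_ : rho0 ^+ 4 = (2 * k) ^+ 2) -?rho0_sq; last by ring.
  rewrite rho0_sq /xi0.
  have -> : 16 / Num.sqrt 3 = 16 * k by [].
  have kN0 : 2 * k != 0 by rewrite gt_eqF // mulr_gt0.
  apply: (mulIf kN0); rewrite divfK //.
  have k4 : k ^+ 4 = 9^-1 by rewrite (exprM k 2 2) k2; field.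
  lra.
split=> //.
  move=> rho xi rho_gt0; rewrite gamma0 d2 /gamma growth_factor21_strassen //.
  have r_gt0 : 0 < rho ^+ 2 by rewrite exprn_gt0.
  rewrite lerD2l ler_pdivlMr // (exprM rho 2 2).
  have := reduced_growth_lb R k (rho ^+ 2) xi k_gt0 k2 r_gt0.
  rewrite -/k; lra.
(* Convergents of the continued fractions of [sqrt 2] and [1 / sqrt 3]. *)
have s2_lb : 1393 / 985 < Num.sqrt 2 :> R.
  by rewrite -(@ltr_pXn2r _ 2) ?nnegrE ?ltW // ?s2; lra.
have k_lb : 2911 / 5042 < k.
  by rewrite -(@ltr_pXn2r _ 2) ?nnegrE ?ltW // ?k2; lra.
rewrite d2 -/k; lra.
Qed.
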